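(* Let $1\le n\le 6$. Among all graphs with $n$ vertices, the empty graph $E_n$ has largest height, width, area, and perimeter; that is, for every rectangle visibility graph $G$ with $n$ vertices, $\operatorname{height}(G)\le\operatorname{height}(E_n)$, $\operatorname{width}(G)\le\operatorname{width}(E_n)$, $\operatorname{area}(G)\le\operatorname{area}(E_n)$, and $\operatorname{perim}(G)\le\operatorname{perim}(E_n)$.
   Context: $E_n$ is the graph with $n$ vertices and no edges. An integer rectangle is a set $[x_1,x_2]\times[y_1,y_2]$ with $x_1<x_2$, $y_1<y_2$ integers. Let $S$ be a finite set of integer rectangles with pairwise disjoint interiors (rectangles may share boundary edges). Two rectangles $A,B\in S$ see each other if there is a vertical or horizontal line segment that intersects the interiors of both $A$ and $B$ and intersects no other (closed) rectangle of $S$. $S$ is an RV-representation of a graph $G$ if the vertices of $G$ correspond bijectively to the rectangles of $S$ so that two vertices are adjacent if and only if their rectangles see each other. A graph having an RV-representation is a rectangle visibility graph (RVG). The bounding box of $S$ is the smallest axis-parallel rectangle $R$ containing all rectangles of $S$; it is always turned (rotated by $90^\circ$ if necessary) so that its height is at most its width. Thus the height of $R$ is its shorter side length and the width of $R$ is its longer side length. For an RVG $G$, $\operatorname{height}(G)$, $\operatorname{width}(G)$, $\operatorname{area}(G)$, $\operatorname{perim}(G)$ (the perimeter of $G$) are the minimum height, width, area, perimeter, respectively, of the bounding box, each minimum being taken separately over all RV-representations of $G$. *)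

(* Defs.v *)
From HB Require Import structures.
From mathcomp Require Import all_boot all_order all_algebra.
From mathcomp Require Import finmap.
From mathcomp Require Import boolp classical_sets set_interval reals.

Set Implicit Arguments.
Unset Strict Implicit.
Unset Printing Implicit Defensive.

Import Order.TTheory GRing.Theory Num.Theory.

Local Open Scope classical_set_scope.
Local Open Scope ring_scope.

Record sgraph := SGraph {
  vertex :> finType;
  adj : rel vertex;
  adj_sym : symmetric adj;
  adj_irrefl : irreflexive adj
}.

Definition edgeless (n : nat) : sgraph :=
  @SGraph 'I_n (fun _ _ => false) (fun _ _ => erefl) (fun _ => erefl).

(* [Rect ((x1, x2), (y1, y2)) _] is the rectangle [x1, x2] x [y1, y2]. *)
Record rect := Rect {
  corners : (int * int) * (int * int);
  _ : (corners.1.1 < corners.1.2) && (corners.2.1 < corners.2.2)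
}.

HB.instance Definition _ := [isSub for corners].
HB.instance Definition _ := [Choice of rect by <:].

Definition x1 (A : rect) : int := (corners A).1.1.
Definition x2 (A : rect) : int := (corners A).1.2.
Definition y1 (A : rect) : int := (corners A).2.1.
Definition y2 (A : rect) : int := (corners A).2.2.

Definition closed_rect (R : realType) (A : rect) : set (R * R) :=
  `[(x1 A)%:~R, (x2 A)%:~R] `*` `[(y1 A)%:~R, (y2 A)%:~R].

Definition rect_interior (R : realType) (A : rect) : set (R * R) :=
  `](x1 A)%:~R, (x2 A)%:~R[ `*` `](y1 A)%:~R, (y2 A)%:~R[.

Arguments closed_rect : clear implicits.
Arguments rect_interior : clear implicits.

Definition disjoint_interiors (R : realType) (S : {fset rect}) : Prop :=
  forall A B, A \in S -> B \in S -> A != B ->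
    rect_interior R A `&` rect_interior R B = set0.

Definition vertical_segment (R : realType) (s : set (R * R)) : Prop :=
  exists x a b : R, a < b /\ s = [set x] `*` `[a, b].

Definition horizontal_segment (R : realType) (s : set (R * R)) : Prop :=
  exists y a b : R, a < b /\ s = `[a, b] `*` [set y].

Definition sees (R : realType) (S : {fset rect}) (A B : rect) : Prop :=
  exists s : set (R * R),
    [/\ vertical_segment s \/ horizontal_segment s,
        s `&` rect_interior R A !=set0,
        s `&` rect_interior R B !=set0 &
        forall C, C \in S -> C != A -> C != B ->
          s `&` closed_rect R C = set0].

(* Every rectangle sees itself, hence the restriction to distinct vertices. *)
Definition rv_representation (R : realType) (S : {fset rect}) (G : sgraph) :
    Prop :=
  disjoint_interiors R S /\
  exists f : G -> rect,
    [/\ injective f,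
        forall A, A \in S <-> exists v, f v = A &
        forall u v, u != v -> (adj u v <-> sees R S (f u) (f v))].

Definition is_rvg (R : realType) (G : sgraph) : Prop :=
  exists S, rv_representation R S G.

(* The smallest real axis-parallel rectangle containing a nonempty finite set
   of integer rectangles has integer corners, so it can be taken in [rect]. *)
Definition bounding_box (R : realType) (S : {fset rect}) (B : rect) : Prop :=
  (forall A, A \in S -> closed_rect R A `<=` closed_rect R B) /\
  forall a b c d : R,
    (forall A, A \in S -> closed_rect R A `<=` `[a, b] `*` `[c, d]) ->
    closed_rect R B `<=` `[a, b] `*` `[c, d].

Definition x_length (B : rect) : nat := `|x2 B - x1 B|%N.
Definition y_length (B : rect) : nat := `|y2 B - y1 B|%N.

(* Shorter and longer side: boxes are turned so that height <= width. *)
Definition box_height (B : rect) : nat := minn (x_length B) (y_length B).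
Definition box_width (B : rect) : nat := maxn (x_length B) (y_length B).
Definition box_area (B : rect) : nat := (box_height B * box_width B)%N.
Definition box_perim (B : rect) : nat := (2 * (box_height B + box_width B))%N.

(* The least element of [P], and 0 by convention when [P] is empty. *)
Definition min_nat (P : set nat) : nat :=
  if pselect (exists m, `[< P m >]) is left exP then ex_minn exP else 0%N.

Lemma min_natP (P : set nat) :
  P !=set0 -> P (min_nat P) /\ forall m, P m -> (min_nat P <= m)%N.
Proof.
move=> [m0 Pm0]; rewrite /min_nat; case: pselect => [exP|nexP].
  case: ex_minnP => m /asboolP Pm min_m; split=> // k Pk.
  exact/min_m/asboolP.
by case: nexP; exists m0; apply/asboolP.
Qed.

Definition min_over_boxes (R : realType) (G : sgraph) (q : rect -> nat) : nat :=
  min_nat [set m | exists S B,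
    [/\ rv_representation R S G, bounding_box R S B & q B = m]].

Definition height (R : realType) (G : sgraph) := min_over_boxes R G box_height.
Definition width (R : realType) (G : sgraph) := min_over_boxes R G box_width.
Definition area (R : realType) (G : sgraph) := min_over_boxes R G box_area.
Definition perim (R : realType) (G : sgraph) := min_over_boxes R G box_perim.

(* Main.v *)
Require Import Defs.
From mathcomp Require Import all_boot all_order all_algebra.
From mathcomp Require Import finmap boolp classical_sets reals.
From mathcomp Require Import zify lra.

(** Cut the plane into unit strips k < x < k + 1 with k an integer.  A rectangle
that meets the middle line of a strip crosses the whole strip, and two
consecutive rectangles on such a line see each other.  In a representation of
the edgeless graph every vertical or horizontal strip therefore carries at most
one rectangle, and n rectangles need n columns and n rows ([edgeless_box]).
Conversely n unit squares on a diagonal fit in an n by n box, so the edgeless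
graph has height n, width n, area n ^ 2 and perimeter 4 n, and the theorem
amounts to the claim that for n <= 6 every graph with n vertices has a
representation whose bounding box is the square of side n ([fits_frame]).

That claim is a finite computation, based on an explicit drawing for each graph
with n <= 6 vertices up to isomorphism.  A graph with an isolated vertex is
drawn by adding a unit square at the corner of a drawing of the rest, which
costs exactly one row and one column; this leaves the 155 graphs without
isolated vertices, which are listed.

Completeness of the list is proved by induction on the number of vertices
([catalogue_complete]).  A graph with n + 1 vertices is a graph with n vertices,
hence by induction one of the drawn ones, together with a new vertex and its row
of adjacencies.  It is enough to check for each drawn graph on n vertices and
each of the 2 ^ n rows that the resulting graph is drawn too
([extensions_covered]).

The link with the geometric definition is [seesP]: since all coordinates are
integers, a line of sight can be moved to the middle of a unit strip, which
makes visibility a finite condition on integer coordinates ([in_sight]), and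
for a drawing in a box of side n a decidable one ([box_sees]). *)

Set Implicit Arguments.
Unset Strict Implicit.
Unset Printing Implicit Defensive.

Import Order.TTheory GRing.Theory Num.Theory.

(** * Visibility in terms of integer coordinates *)

Local Open Scope ring_scope.

(** The boolean [d] selects an axis, [true] for x and [false] for y, so that
vertical and horizontal visibility are treated at once. *)
Definition lo (d : bool) (A : rect) : int := if d then x1 A else y1 A.
Definition hi (d : bool) (A : rect) : int := if d then x2 A else y2 A.

(** The integer [k] stands for the open strip between [k] and [k + 1]. *)
Definition crosses (d : bool) (k : int) (A : rect) : bool :=
  lo d A <= k < hi d A.

Definition between (d : bool) (A C B : rect) : bool :=
  (hi d A <= lo d C) && (hi d C <= lo d B).

Definition apart (d : bool) (A B : rect) : bool :=
  (hi d A <= lo d B) || (hi d B <= lo d A).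

(** The strip [k] is one in which the line of sight can run; it is orthogonal to
the axis [d], so obstacles are located along the other axis. *)
Definition in_sight (S : {fset rect}) (A B : rect) : Prop :=
  exists d k, [/\ crosses d k A, crosses d k B &
    forall C, C \in S -> crosses d k C ->
      ~~ (between (~~ d) A C B || between (~~ d) B C A)].

Lemma lo_lt_hi d A : lo d A < hi d A.
Proof. by case: A => c c_ok; case/andP: (c_ok); case: d. Qed.

(** Rectangles on a common strip can only be separated along that strip. *)
Lemma apart_across d d' k A B :
  crosses d k A -> crosses d k B -> apart d' A B -> apart (~~ d) A B.
Proof.
case: (d' =P ~~ d) => [-> //|/eqP d'd]; have -> : d' = d by case: d' d d'd => -[].
by rewrite /crosses /apart; lia.
Qed.

Definition pcoord (R : realType) (d : bool) (p : R * R) : R := if d then p.1 else p.2.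

Definition point (R : realType) (d : bool) (t u : R) : R * R :=
  if d then (t, u) else (u, t).

Lemma pcoord_point (R : realType) d (t u : R) : pcoord d (point d t u) = t.
Proof. by case: d. Qed.

Lemma pcoordN_point (R : realType) d (t u : R) : pcoord (~~ d) (point d t u) = u.
Proof. by case: d. Qed.

Lemma interiorP (R : realType) A (p : R * R) :
  rect_interior R A p <->
  forall d, (lo d A)%:~R < pcoord d p < (hi d A)%:~R.
Proof.
rewrite /rect_interior /=; split.
  by case=> /= + + [] /=; rewrite !in_itv.
by move=> H; split; rewrite /= in_itv; [exact: (H true) | exact: (H false)].
Qed.

Lemma closedP (R : realType) A (p : R * R) :
  closed_rect R A p <->
  forall d, (lo d A)%:~R <= pcoord d p <= (hi d A)%:~R.
Proof.
rewrite /closed_rect /=; split.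
  by case=> /= + + [] /=; rewrite !in_itv.
by move=> H; split; rewrite /= in_itv; [exact: (H true) | exact: (H false)].
Qed.

Lemma forall_dirs d (P : bool -> Prop) : P d -> P (~~ d) -> forall d', P d'.
Proof. by case: d => /= ? ? []. Qed.

Lemma segmentP (R : realType) (s : set (R * R)) :
  vertical_segment s \/ horizontal_segment s <->
  exists d t a b, a < b /\
    forall p, s p <-> pcoord d p = t /\ a <= pcoord (~~ d) p <= b.
Proof.
split.
  case=> -[t [a [b [ltab ->]]]]; [exists true | exists false];
    exists t, a, b; split=> // -[x y] /=; rewrite in_itv /=; tauto.
case=> -[] [t [a [b [ltab sE]]]]; [left | right]; exists t, a, b; split=> //;
  apply/seteqP; split=> -[x y]; rewrite sE /= in_itv /=; tauto.
Qed.

Lemma le_half (R : realType) (m k : int) : (m%:~R <= k%:~R + 2^-1 :> R) = (m <= k).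
Proof.
have half : 0 < (2^-1 : R) < 1 by apply/andP; split; lra.
apply/idP/idP => [le_m|]; last by rewrite -(ler_int R); lra.
by rewrite -ltzD1 -(ltr_int R) intrD; lra.
Qed.

Lemma half_le (R : realType) (m k : int) : (k%:~R + 2^-1 <= m%:~R :> R) = (k < m).
Proof.
have half : 0 < (2^-1 : R) < 1 by apply/andP; split; lra.
apply/idP/idP => [le_m|]; first by rewrite -(ltr_int R); lra.
by rewrite -lezD1 -(ler_int R) intrD; lra.
Qed.

Lemma lt_half (R : realType) (m k : int) : (m%:~R < k%:~R + 2^-1 :> R) = (m <= k).
Proof. by rewrite ltNge half_le -leNgt. Qed.

Lemma half_lt (R : realType) (m k : int) : (k%:~R + 2^-1 < m%:~R :> R) = (k < m).
Proof. by rewrite ltNge le_half -ltNge. Qed.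

(** If no axis separates two rectangles, the unit cell whose lower corner is given
by the larger of the lower coordinates lies in both of them. *)
Lemma disjoint_interiorsP (R : realType) S :
  disjoint_interiors R S <->
  forall A B, A \in S -> B \in S -> A != B -> exists d, apart d A B.
Proof.
split=> disjS A B AS BS neqAB; last first.
  have [d dAB] := disjS A B AS BS neqAB.
  apply/seteqP; split=> // p.
  move=> [/interiorP/(_ d) /andP[lA hA] /interiorP/(_ d) /andP[lB hB]].
  by case/orP: dAB; rewrite -(ler_int R) => ?; lra.
apply: contrapT => /forallNP notapart.
pose k d := Num.max (lo d A) (lo d B).
have kAB d : [&& lo d A <= k d, k d < hi d A, lo d B <= k d & k d < hi d B].
  have := notapart d; rewrite /apart /k => /negP; rewrite negb_or -!ltNge.
  by have := lo_lt_hi d A; have := lo_lt_hi d B; lia.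
have AB0 := disjS A B AS BS neqAB.
suff: (rect_interior R A `&` rect_interior R B)%classic
    ((k true)%:~R + 2^-1, (k false)%:~R + 2^-1) by rewrite AB0.
by split; apply/interiorP => -[] /=; rewrite lt_half half_lt;
  [have := kAB true | have := kAB false | have := kAB true | have := kAB false];
  case/and4P => *; apply/andP.
Qed.

Lemma sees_sym (R : realType) S A B : sees R S A B = sees R S B A.
Proof.
by apply/propext; split=> -[s [seg sA sB clear_s]]; exists s; split=> // C CS *;
  apply: clear_s.
Qed.

(** A line of sight at coordinate t stays in the strip of the integer part of t, and
every rectangle crossing this strip also meets the line, even when t is an
integer.  Conversely a segment in the middle of the strip reaching only half a
unit into the two rectangles can be stopped only by what lies between them. *)
Lemma seesP (R : realType) S A B : disjoint_interiors R S ->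
  A \in S -> B \in S -> A != B -> sees R S A B <-> in_sight S A B.
Proof.
move=> /disjoint_interiorsP disjS AS BS neqAB; split.
  case=> s [/segmentP[d [t [a [b [ltab sE]]]]] [p [sp Ap]] [q [sq Bq]] clear_s].
  have {sp} [pt pab] := (sE p).1 sp; have {sq} [qt qab] := (sE q).1 sq.
  move/interiorP: Ap => Ap; move/interiorP: Bq => Bq.
  have crossI C : (lo d C)%:~R < t < (hi d C)%:~R -> crosses d (Num.floor t) C.
    move=> /andP[lC hC]; rewrite /crosses floor_ge_int ltW //=.
    by rewrite floor_lt_int.
  have blocked C : C \in S -> crosses d (Num.floor t) C -> C != A -> C != B ->
      ~ a <= (lo (~~ d) C)%:~R <= b.
    move=> CS /andP[lC hC] CA CB abC.
    suff: (s `&` closed_rect R C)%classic (point d t (lo (~~ d) C)%:~R).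
      by rewrite clear_s.
    split; first by rewrite sE pcoord_point pcoordN_point.
    apply/closedP; apply: (forall_dirs (d := d));
      rewrite /= ?pcoord_point ?pcoordN_point.
      by rewrite -floor_ge_int lC /= ltW // -floor_lt_int.
    by rewrite lexx ler_int ltW // lo_lt_hi.
  have notAB C : between (~~ d) A C B || between (~~ d) B C A ->
      (C != A) && (C != B).
    have := lo_lt_hi (~~ d) C; rewrite -negb_or => ltC.
    by apply: contraL => /orP[]/eqP CE; rewrite CE in ltC *; rewrite /between;
      have := lo_lt_hi (~~ d) A; have := lo_lt_hi (~~ d) B; lia.
  have := Ap (~~ d); have := Bq (~~ d); have := Ap d; have := Bq d.
  rewrite pt qt => tB tA => /andP[lB hB] /andP[lA hA].
  exists d, (Num.floor t); split; [exact: crossI | exact: crossI |] => C CS tC.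
  apply/negP => bC; have /andP[CA CB] := notAB C bC.
  apply: (blocked C CS tC CA CB).
  have := lo_lt_hi (~~ d) C; rewrite -(ltr_int R).
  case/orP: bC => /andP[]; rewrite -!(ler_int R); lra.
case=> d [k [kA kB clear_k]].
wlog AbelowB : A B AS BS neqAB kA kB clear_k / hi (~~ d) A <= lo (~~ d) B.
  move=> wl; have := disjS A B AS BS neqAB.
  case=> d' /(apart_across kA kB)/orP[|BA]; first exact: wl.
  rewrite sees_sym; apply: wl => //; first by rewrite eq_sym.
  by move=> C CS kC; rewrite orbC clear_k.
have apart_in C D : C \in S -> D \in S -> C != D ->
    crosses d k C -> crosses d k D -> apart (~~ d) C D.
  move=> CS DS CD kC kD; have [d'] := disjS C D CS DS CD.
  exact: apart_across kC kD.
pose top : int := hi (~~ d) A - 1; pose bot := lo (~~ d) B.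
exists [set p | pcoord d p = k%:~R + 2^-1 /\
  top%:~R + 2^-1 <= pcoord (~~ d) p <= bot%:~R + 2^-1]%classic.
have topbot : (top%:~R + 2^-1 : R) < bot%:~R + 2^-1.
  by rewrite ltrD2r ltr_int /top /bot; lia.
have inside C u : crosses d k C -> crosses (~~ d) u C ->
    rect_interior R C (point d (k%:~R + 2^-1) (u%:~R + 2^-1)).
  move=> kC uC; apply/interiorP; apply: (forall_dirs (d := d)) => /=.
    by rewrite pcoord_point lt_half half_lt.
  by rewrite pcoordN_point lt_half half_lt.
split.
- by apply/segmentP; exists d, (k%:~R + 2^-1), (top%:~R + 2^-1), (bot%:~R + 2^-1).
- exists (point d (k%:~R + 2^-1) (top%:~R + 2^-1)); split.
    by rewrite /= pcoord_point pcoordN_point lexx ltW.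
  by apply: inside => //; rewrite /crosses /top; have := lo_lt_hi (~~ d) A; lia.
- exists (point d (k%:~R + 2^-1) (bot%:~R + 2^-1)); split.
    by rewrite /= pcoord_point pcoordN_point lexx ltW.
  by apply: inside => //; rewrite /crosses /bot; have := lo_lt_hi (~~ d) B; lia.
move=> C CS CA CB; apply/seteqP; split=> // p [[/= pk /andP[lp hp]]].
move/closedP => pC; have := pC d; rewrite pk le_half half_le => kC.
have /andP[lC hC] := pC (~~ d).
have Cbot : lo (~~ d) C <= bot by rewrite -(le_half R) (le_trans lC).
have topC : top < hi (~~ d) C by rewrite -(half_le R) (le_trans lp).
have AC : hi (~~ d) A <= lo (~~ d) C.
  have /orP[//|CbelowA] : apart (~~ d) A C by apply: apart_in; rewrite // eq_sym.
  by move: topC; rewrite /top; have := lo_lt_hi (~~ d) A; clear -CbelowA; lia.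
have CB' : hi (~~ d) C <= lo (~~ d) B.
  have /orP[//|BbelowC] : apart (~~ d) C B by apply: apart_in.
  by move: Cbot; rewrite /bot; have := lo_lt_hi (~~ d) B; clear -BbelowC; lia.
by have := clear_k C CS kC; rewrite /between AC CB'.
Qed.

(** * The edgeless graph needs many rows and columns *)

Lemma closed_rect_subP (R : realType) (A B : rect) :
  (closed_rect R A `<=` closed_rect R B)%classic <->
  forall d, lo d B <= lo d A /\ hi d A <= hi d B.
Proof.
split=> [sAB d|sAB p /closedP pA].
  have loA : closed_rect R A ((lo true A)%:~R, (lo false A)%:~R).
    by apply/closedP => -[]; rewrite lexx ler_int ltW // lo_lt_hi.
  have hiA : closed_rect R A ((hi true A)%:~R, (hi false A)%:~R).
    by apply/closedP => -[]; rewrite lexx ler_int ltW // lo_lt_hi.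
  have /closedP/(_ d)/andP[] := sAB _ loA; have /closedP/(_ d)/andP[] := sAB _ hiA.
  by case: d {loA hiA}; rewrite /= !ler_int.
apply/closedP => d; have := pA d; have := sAB d.
by rewrite -!(ler_int R); lra.
Qed.

(** Were [f u] and [f v] on a common strip, the rectangle nearest to [f u] on it,
on the side of [f v], would be seen from [f u]. *)
Lemma lane_unique (R : realType) (S : {fset rect}) (G : sgraph)
    (f : G -> rect) (d : bool) (k : int) (u v : G) :
  disjoint_interiors R S -> injective f ->
  (forall A, A \in S <-> exists v, f v = A) ->
  (forall u v, u != v -> ~ sees R S (f u) (f v)) ->
  crosses d k (f u) -> crosses d k (f v) -> u = v.
Proof.
move=> disjS f_inj fS unseen ku kv; apply/eqP/contraT => neq_uv.
have fin w : f w \in S by apply/fS; exists w.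
wlog uv : u v ku kv neq_uv / hi (~~ d) (f u) <= lo (~~ d) (f v).
  move=> wl; have := disjS; rewrite disjoint_interiorsP => /(_ _ _ (fin u) (fin v)).
  case=> [|d' /(apart_across ku kv)/orP[|]]; first by rewrite (inj_eq f_inj).
    exact: wl.
  by apply: wl; rewrite // eq_sym.
pose above w := crosses d k (f w) && (hi (~~ d) (f u) <= lo (~~ d) (f w)).
have above_v : above v by rewrite /above kv.
have := @arg_minP _ int G v above (fun w => lo (~~ d) (f w)) above_v.
case=> w /andP[kw uw] w_min.
have neq_uw : u != w.
  by apply: contraTneq uw => <-; rewrite -ltNge lo_lt_hi.
case: (unseen u w neq_uw); apply/seesP; rewrite ?(inj_eq f_inj) //.
exists d, k; split=> // C /fS[z <-] kz; apply/negP; rewrite /between.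
have := lo_lt_hi (~~ d) (f z); have := lo_lt_hi (~~ d) (f w).
have := lo_lt_hi (~~ d) (f u) => ltu ltw ltz.
case/orP=> /andP[h1 h2]; last by lia.
have : above z by rewrite /above kz.
by move/w_min; lia.
Qed.

(** The strips starting at the lower sides of the rectangles are distinct, and all
of them cross [B]. *)
Lemma edgeless_box (R : realType) (n : nat) (S : {fset rect})
    (B : rect) (d : bool) :
  rv_representation R S (edgeless n) ->
  (forall A, A \in S -> closed_rect R A `<=` closed_rect R B)%classic ->
  (n <= `|hi d B - lo d B|)%N.
Proof.
case=> disjS [f [f_inj fS adjE]] inB.
have inBox v : lo d B <= lo d (f v) < hi d B.
  have /inB/closed_rect_subP/(_ d) : f v \in S by apply/fS; exists v.
  by have := lo_lt_hi d (f v); lia.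
pose offset (v : 'I_n) := `|lo d (f v) - lo d B|%N.
have lt_offset v : (offset v < `|hi d B - lo d B|)%N.
  by rewrite /offset; have := inBox v; lia.
have /leq_card : injective (fun v => Ordinal (lt_offset v)); last by rewrite !card_ord.
move=> u v [] eq_uv; have {}eq_uv : lo d (f u) = lo d (f v).
  by move: eq_uv; rewrite /offset; have := inBox u; have := inBox v; lia.
apply: (@lane_unique R S (edgeless n) f d (lo d (f u))) => //.
- by move=> x y /adjE [_ no_edge] /no_edge.
- by rewrite /crosses lexx lo_lt_hi.
- by rewrite /crosses eq_uv lexx lo_lt_hi.
Qed.

(** * Drawings on the integer grid *)

Local Close Scope ring_scope.

Definition box := ((nat * nat) * (nat * nat))%type.
Definition drawing := seq box.
Definition Box (a b c d : nat) : box := ((a, b), (c, d)).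

Definition extent (d : bool) (b : box) : nat * nat := if d then b.1 else b.2.

Definition box_crosses (d : bool) (k : nat) (A : box) : bool :=
  (extent d A).1 <= k < (extent d A).2.

Definition box_between (d : bool) (A C B : box) : bool :=
  ((extent d A).2 <= (extent d C).1) && ((extent d C).2 <= (extent d B).1).

Definition box_apart (d : bool) (A B : box) : bool :=
  ((extent d A).2 <= (extent d B).1) || ((extent d B).2 <= (extent d A).1).

(** The counterpart of [in_sight]; [n] bounds the coordinates of [D]. *)
Definition box_sees (n : nat) (D : drawing) (A B : box) : bool :=
  has (fun d => has (fun k =>
    [&& box_crosses d k A, box_crosses d k B &
      all (fun C => box_crosses d k C ==>
        ~~ (box_between (~~ d) A C B || box_between (~~ d) B C A)) D])
    (iota 0 n)) [:: true; false].

(** The boxes are required to touch all four sides, so that the bounding box is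
the full square of side [n]. *)
Definition tight_drawing (n : nat) (D : drawing) : bool :=
  [&& size D == n,
      all (fun A => all (fun d =>
        (extent d A).1 < (extent d A).2 <= n) [:: true; false]) D,
      all (fun d => has (fun A => (extent d A).1 == 0) D &&
        has (fun A => (extent d A).2 == n) D) [:: true; false] &
      pairwise (fun A B => has (fun d => box_apart d A B) [:: true; false]) D].

(** Each of the lists [drawings2] to [drawings6] has one drawing per isomorphism class
of graphs without isolated vertices, by increasing number of edges. *)
Definition drawings2 : seq drawing :=
  [:: [:: Box 0 2 0 1; Box 1 2 1 2]].

Definition drawings3 : seq drawing :=
  [:: [:: Box 0 1 0 1; Box 0 1 2 3; Box 2 3 0 1];
      [:: Box 0 3 0 1; Box 1 2 2 3; Box 2 3 2 3]].

Definition drawings4 : seq drawing :=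
  [:: [:: Box 0 1 3 4; Box 2 3 0 1; Box 2 3 2 3; Box 3 4 3 4];
      [:: Box 0 1 0 1; Box 0 1 2 3; Box 0 1 3 4; Box 3 4 2 3];
      [:: Box 0 1 0 1; Box 0 1 3 4; Box 1 2 0 1; Box 3 4 3 4];
      [:: Box 0 1 0 1; Box 2 3 0 1; Box 2 4 3 4; Box 3 4 0 1];
      [:: Box 0 1 0 1; Box 0 1 2 4; Box 2 4 3 4; Box 3 4 0 1];
      [:: Box 0 1 0 2; Box 2 4 0 1; Box 2 4 3 4; Box 3 4 1 2];
      [:: Box 0 1 0 2; Box 0 3 3 4; Box 1 4 0 1; Box 2 3 1 2]].

Definition drawings5 : seq drawing :=
  [:: [:: Box 0 1 1 2; Box 2 3 0 1; Box 2 3 4 5; Box 3 4 1 2; Box 4 5 1 2];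
      [:: Box 0 1 0 1; Box 0 3 3 4; Box 1 2 2 3; Box 2 3 4 5; Box 4 5 3 4];
      [:: Box 0 1 0 2; Box 2 3 1 2; Box 2 3 3 4; Box 2 3 4 5; Box 4 5 3 4];
      [:: Box 0 1 0 1; Box 2 3 3 4; Box 2 4 0 1; Box 4 5 3 4; Box 4 5 4 5];
      [:: Box 0 3 4 5; Box 1 2 2 3; Box 2 3 2 3; Box 3 4 0 1; Box 4 5 0 1];
      [:: Box 0 1 0 1; Box 2 3 2 3; Box 2 5 0 1; Box 3 4 2 3; Box 4 5 4 5];
      [:: Box 0 1 4 5; Box 2 3 4 5; Box 2 5 0 1; Box 3 4 2 3; Box 4 5 3 5];
      [:: Box 0 1 0 3; Box 1 2 0 1; Box 3 4 1 2; Box 3 5 0 1; Box 4 5 4 5];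
      [:: Box 0 1 0 1; Box 0 2 2 3; Box 1 2 3 4; Box 1 2 4 5; Box 4 5 3 5];
      [:: Box 0 1 0 1; Box 0 1 2 5; Box 2 3 3 4; Box 3 4 3 4; Box 3 5 0 1];
      [:: Box 0 1 1 3; Box 2 3 0 1; Box 2 3 2 3; Box 3 4 0 3; Box 3 5 4 5];
      [:: Box 0 1 0 2; Box 3 4 1 2; Box 3 4 2 3; Box 3 5 4 5; Box 4 5 1 4];
      [:: Box 0 5 4 5; Box 1 2 0 1; Box 2 3 1 2; Box 3 4 0 2; Box 3 4 3 4];
      [:: Box 0 2 0 1; Box 1 3 3 4; Box 2 3 0 1; Box 2 3 4 5; Box 4 5 2 5];
      [:: Box 0 1 3 4; Box 0 2 0 1; Box 1 2 2 5; Box 4 5 0 2; Box 4 5 3 4];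
      [:: Box 0 2 2 3; Box 2 3 2 3; Box 2 5 0 1; Box 2 5 4 5; Box 4 5 2 3];
      [:: Box 0 1 0 1; Box 0 1 1 3; Box 0 2 4 5; Box 1 2 0 2; Box 4 5 0 4];
      [:: Box 0 5 4 5; Box 1 2 1 2; Box 1 3 0 1; Box 3 4 1 2; Box 4 5 0 1];
      [:: Box 0 3 4 5; Box 1 3 0 1; Box 2 4 3 4; Box 4 5 0 1; Box 4 5 3 5];
      [:: Box 0 5 4 5; Box 1 2 1 2; Box 1 4 0 1; Box 3 4 1 2; Box 4 5 0 1];
      [:: Box 0 5 0 1; Box 1 2 3 5; Box 2 3 2 3; Box 2 4 4 5; Box 3 4 2 4];
      [:: Box 0 1 1 2; Box 0 4 4 5; Box 0 5 0 1; Box 2 3 1 2; Box 3 4 1 2];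
      [:: Box 0 1 0 5; Box 1 3 2 3; Box 2 4 0 1; Box 2 5 4 5; Box 4 5 0 3]].

Definition drawings6 : seq drawing :=
  [:: [:: Box 0 1 0 1; Box 0 1 4 5; Box 1 2 5 6; Box 3 4 3 4; Box 3 5 1 2; Box 5 6 5 6];
      [:: Box 0 1 1 3; Box 2 3 0 1; Box 2 3 3 5; Box 2 3 5 6; Box 4 5 4 5; Box 5 6 1 2];
      [:: Box 0 1 0 1; Box 0 1 1 2; Box 0 1 2 3; Box 4 5 3 4; Box 4 5 4 6; Box 5 6 3 4];
      [:: Box 0 1 2 3; Box 0 1 5 6; Box 3 4 3 4; Box 3 4 5 6; Box 4 6 0 1; Box 5 6 1 2];
      [:: Box 0 1 1 2; Box 2 3 0 1; Box 3 4 0 5; Box 3 4 5 6; Box 4 5 4 5; Box 5 6 1 2];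
      [:: Box 0 1 5 6; Box 0 3 1 2; Box 1 2 0 1; Box 2 4 2 3; Box 4 5 1 2; Box 5 6 1 2];
      [:: Box 0 1 2 3; Box 1 2 0 1; Box 1 2 2 3; Box 2 3 3 4; Box 3 6 5 6; Box 4 5 2 4];
      [:: Box 0 1 0 1; Box 0 1 4 5; Box 2 3 0 1; Box 3 6 4 5; Box 5 6 3 4; Box 5 6 5 6];
      [:: Box 0 1 0 2; Box 0 1 4 5; Box 3 4 0 1; Box 4 5 5 6; Box 4 6 2 3; Box 5 6 5 6];
      [:: Box 0 1 0 1; Box 0 1 4 5; Box 0 1 5 6; Box 3 4 0 1; Box 4 5 4 5; Box 4 6 2 3];
      [:: Box 0 1 0 2; Box 2 3 0 1; Box 2 3 1 2; Box 2 3 4 5; Box 4 6 5 6; Box 5 6 3 4];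
      [:: Box 0 1 0 2; Box 0 1 4 5; Box 3 4 0 1; Box 3 5 2 3; Box 4 5 5 6; Box 5 6 5 6];
      [:: Box 0 1 0 1; Box 0 1 5 6; Box 1 2 2 4; Box 2 3 3 4; Box 3 4 2 3; Box 5 6 1 4];
      [:: Box 0 1 2 3; Box 0 1 3 5; Box 2 4 5 6; Box 3 4 0 1; Box 3 4 2 5; Box 5 6 3 5];
      [:: Box 0 1 2 3; Box 1 2 0 1; Box 1 2 2 3; Box 1 2 3 4; Box 3 6 5 6; Box 4 5 2 4];
      [:: Box 0 1 0 1; Box 0 1 5 6; Box 2 6 5 6; Box 3 4 0 1; Box 4 5 4 5; Box 5 6 1 2];
      [:: Box 0 2 0 2; Box 1 2 2 3; Box 1 2 5 6; Box 3 4 0 1; Box 4 5 2 3; Box 5 6 0 2];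
      [:: Box 0 1 0 2; Box 0 1 3 4; Box 0 1 5 6; Box 2 4 0 1; Box 3 4 3 5; Box 4 6 0 1];
      [:: Box 0 1 2 3; Box 0 1 3 5; Box 2 4 5 6; Box 4 5 0 1; Box 4 5 3 4; Box 5 6 3 6];
      [:: Box 0 1 4 6; Box 0 2 0 1; Box 1 4 4 5; Box 3 4 2 3; Box 5 6 1 2; Box 5 6 4 5];
      [:: Box 0 1 0 1; Box 1 3 2 3; Box 2 3 3 4; Box 2 3 5 6; Box 4 5 2 3; Box 5 6 0 4];
      [:: Box 0 3 3 4; Box 1 2 0 2; Box 1 2 5 6; Box 2 3 5 6; Box 3 4 4 6; Box 5 6 0 1];
      [:: Box 0 1 0 2; Box 0 1 2 3; Box 0 1 3 6; Box 2 3 2 3; Box 5 6 0 1; Box 5 6 2 3];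
      [:: Box 0 1 4 6; Box 2 4 5 6; Box 3 5 4 5; Box 4 5 0 1; Box 4 5 3 4; Box 5 6 0 1];
      [:: Box 0 2 0 1; Box 1 2 4 6; Box 2 3 0 1; Box 3 6 3 4; Box 4 5 4 5; Box 5 6 5 6];
      [:: Box 0 1 5 6; Box 0 3 3 4; Box 1 2 4 6; Box 2 3 4 5; Box 4 6 0 1; Box 5 6 2 3];
      [:: Box 0 2 2 3; Box 1 2 1 2; Box 1 2 4 5; Box 2 3 4 6; Box 2 5 0 1; Box 5 6 0 2];
      [:: Box 0 2 4 5; Box 0 4 0 1; Box 3 4 3 5; Box 4 5 1 2; Box 4 6 5 6; Box 5 6 1 2];
      [:: Box 0 1 5 6; Box 0 2 0 1; Box 1 6 5 6; Box 3 4 0 1; Box 4 5 4 5; Box 5 6 1 2];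
      [:: Box 0 2 5 6; Box 1 2 2 5; Box 2 3 4 5; Box 3 4 2 3; Box 3 6 0 1; Box 4 5 2 4];
      [:: Box 0 1 4 5; Box 3 4 2 3; Box 3 4 3 6; Box 4 5 4 6; Box 5 6 0 1; Box 5 6 2 5];
      [:: Box 0 1 4 5; Box 2 3 3 5; Box 4 5 2 3; Box 4 5 4 6; Box 5 6 0 1; Box 5 6 2 5];
      [:: Box 0 1 1 3; Box 2 3 5 6; Box 3 4 0 2; Box 3 5 4 5; Box 4 6 1 2; Box 4 6 5 6];
      [:: Box 0 1 1 3; Box 0 3 0 1; Box 1 2 3 4; Box 4 5 0 1; Box 4 5 2 6; Box 5 6 4 5];
      [:: Box 0 1 2 6; Box 1 3 0 1; Box 1 3 3 4; Box 2 3 1 2; Box 2 3 5 6; Box 5 6 3 4];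
      [:: Box 0 1 2 3; Box 1 2 0 3; Box 1 2 4 5; Box 2 3 1 2; Box 2 3 3 6; Box 5 6 0 2];
      [:: Box 0 1 0 2; Box 2 3 5 6; Box 2 5 3 4; Box 3 4 1 2; Box 4 5 5 6; Box 4 6 1 2];
      [:: Box 0 2 4 5; Box 1 3 0 1; Box 2 3 1 2; Box 4 5 5 6; Box 4 6 0 1; Box 5 6 4 6];
      [:: Box 0 1 1 2; Box 0 1 2 4; Box 1 4 5 6; Box 2 3 1 2; Box 2 3 3 4; Box 5 6 0 3];
      [:: Box 0 2 0 1; Box 1 2 3 6; Box 2 3 0 1; Box 3 6 3 4; Box 4 5 4 5; Box 5 6 5 6];
      [:: Box 0 1 5 6; Box 0 3 0 1; Box 1 2 1 3; Box 2 4 1 2; Box 3 4 5 6; Box 5 6 2 4];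
      [:: Box 0 1 0 4; Box 2 3 0 1; Box 2 3 1 2; Box 2 3 3 4; Box 3 6 5 6; Box 4 5 3 4];
      [:: Box 0 2 4 5; Box 0 4 0 1; Box 1 3 3 4; Box 3 4 3 5; Box 5 6 1 2; Box 5 6 5 6];
      [:: Box 0 4 5 6; Box 3 4 1 2; Box 3 5 4 5; Box 4 5 0 2; Box 5 6 3 5; Box 5 6 5 6];
      [:: Box 0 1 3 4; Box 0 2 4 5; Box 1 2 0 2; Box 2 3 4 5; Box 4 6 1 2; Box 5 6 3 6];
      [:: Box 0 1 3 5; Box 0 2 1 2; Box 1 2 0 1; Box 4 5 0 1; Box 4 5 3 4; Box 5 6 3 6];
      [:: Box 0 1 1 2; Box 0 1 2 4; Box 1 4 5 6; Box 2 3 3 4; Box 3 4 2 3; Box 5 6 0 3];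
      [:: Box 0 1 0 2; Box 0 1 2 6; Box 2 3 4 5; Box 2 5 2 3; Box 5 6 0 1; Box 5 6 1 2];
      [:: Box 0 2 1 2; Box 0 5 0 1; Box 1 4 4 5; Box 2 3 1 3; Box 4 5 5 6; Box 5 6 0 1];
      [:: Box 0 1 4 5; Box 3 4 4 6; Box 3 6 2 3; Box 4 5 4 5; Box 4 6 0 1; Box 5 6 4 6];
      [:: Box 0 1 5 6; Box 1 2 1 2; Box 1 4 5 6; Box 2 5 0 1; Box 3 6 1 2; Box 5 6 5 6];
      [:: Box 0 1 3 4; Box 1 2 4 5; Box 1 3 0 1; Box 1 3 3 4; Box 2 6 2 3; Box 5 6 3 6];
      [:: Box 0 1 0 1; Box 1 5 0 1; Box 2 3 5 6; Box 2 4 1 2; Box 3 6 5 6; Box 5 6 0 1];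
      [:: Box 0 1 5 6; Box 1 2 0 2; Box 1 4 5 6; Box 2 4 0 1; Box 3 5 3 4; Box 3 6 1 2];
      [:: Box 0 1 2 4; Box 2 3 0 1; Box 3 4 3 6; Box 3 6 0 1; Box 4 5 1 4; Box 4 5 4 5];
      [:: Box 0 1 0 2; Box 0 1 4 6; Box 1 2 2 3; Box 1 3 1 2; Box 2 6 5 6; Box 5 6 0 2];
      [:: Box 0 2 4 5; Box 2 3 3 5; Box 4 5 2 3; Box 4 5 4 6; Box 4 6 0 1; Box 5 6 2 5];
      [:: Box 0 1 0 3; Box 2 5 0 1; Box 3 4 1 2; Box 3 4 2 3; Box 4 6 2 3; Box 4 6 5 6];
      [:: Box 0 1 5 6; Box 1 2 1 3; Box 1 3 0 1; Box 2 4 1 2; Box 3 4 5 6; Box 5 6 0 4];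
      [:: Box 0 3 2 3; Box 0 4 1 2; Box 0 5 0 1; Box 3 4 3 4; Box 4 5 2 6; Box 5 6 1 3];
      [:: Box 0 1 3 6; Box 2 3 0 4; Box 2 4 4 5; Box 3 4 0 1; Box 4 5 1 2; Box 4 6 3 4];
      [:: Box 0 1 0 6; Box 2 3 2 3; Box 3 4 2 3; Box 3 5 1 2; Box 4 5 4 5; Box 4 6 0 1];
      [:: Box 0 1 2 4; Box 0 2 0 1; Box 0 3 4 5; Box 2 4 5 6; Box 3 6 2 3; Box 5 6 4 5];
      [:: Box 0 1 3 5; Box 0 3 0 1; Box 1 2 3 6; Box 3 4 3 4; Box 5 6 0 1; Box 5 6 3 5];
      [:: Box 0 1 5 6; Box 0 3 0 1; Box 1 2 1 3; Box 2 4 1 2; Box 3 4 5 6; Box 5 6 1 4];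
      [:: Box 0 1 0 2; Box 0 1 4 6; Box 0 2 2 3; Box 1 3 1 2; Box 2 6 5 6; Box 5 6 0 1];
      [:: Box 0 1 0 3; Box 1 2 2 4; Box 1 3 4 5; Box 2 4 0 1; Box 3 4 2 4; Box 5 6 2 6];
      [:: Box 0 1 3 4; Box 0 1 5 6; Box 2 5 0 1; Box 3 4 3 6; Box 4 6 4 5; Box 5 6 0 3];
      [:: Box 0 1 2 6; Box 0 2 1 2; Box 1 2 0 1; Box 3 4 0 2; Box 3 5 5 6; Box 4 6 4 5];
      [:: Box 0 1 2 6; Box 1 2 2 3; Box 3 4 1 3; Box 4 5 1 2; Box 4 6 5 6; Box 5 6 0 3];
      [:: Box 0 1 5 6; Box 1 2 0 2; Box 1 4 5 6; Box 2 5 0 1; Box 3 6 1 2; Box 5 6 5 6];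
      [:: Box 0 3 4 5; Box 0 5 0 1; Box 1 2 3 4; Box 2 3 1 2; Box 4 5 3 6; Box 5 6 5 6];
      [:: Box 0 1 0 1; Box 0 1 2 6; Box 2 4 2 3; Box 2 4 5 6; Box 3 4 3 4; Box 3 6 4 5];
      [:: Box 0 1 5 6; Box 1 2 0 2; Box 1 5 5 6; Box 2 5 0 1; Box 3 5 3 4; Box 4 6 1 2];
      [:: Box 0 4 0 1; Box 1 2 2 6; Box 2 3 3 4; Box 2 5 5 6; Box 4 5 2 3; Box 5 6 2 3];
      [:: Box 0 2 5 6; Box 0 5 0 1; Box 1 4 4 5; Box 2 3 2 3; Box 3 4 1 2; Box 4 6 3 5];
      [:: Box 0 1 3 4; Box 0 3 5 6; Box 1 2 2 3; Box 2 3 0 5; Box 4 5 3 4; Box 5 6 3 6];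
      [:: Box 0 1 3 4; Box 0 2 1 3; Box 1 3 4 5; Box 3 4 2 3; Box 3 4 3 6; Box 5 6 0 4];
      [:: Box 0 1 1 4; Box 0 2 0 1; Box 0 3 5 6; Box 1 2 2 3; Box 2 4 2 3; Box 5 6 3 6];
      [:: Box 0 1 1 3; Box 0 1 5 6; Box 2 3 0 2; Box 2 3 3 4; Box 2 3 4 5; Box 5 6 1 6];
      [:: Box 0 3 0 1; Box 2 4 2 3; Box 2 4 5 6; Box 3 5 3 4; Box 4 6 0 1; Box 5 6 2 4];
      [:: Box 0 3 0 1; Box 2 4 2 3; Box 3 5 3 4; Box 3 6 5 6; Box 4 6 0 1; Box 5 6 2 4];
      [:: Box 0 3 0 1; Box 1 2 3 4; Box 2 3 4 6; Box 3 4 1 5; Box 3 5 5 6; Box 3 6 0 1];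
      [:: Box 0 1 1 4; Box 0 2 0 1; Box 0 3 5 6; Box 1 2 2 3; Box 1 2 3 4; Box 5 6 3 6];
      [:: Box 0 4 0 1; Box 1 2 2 3; Box 3 4 3 5; Box 3 5 2 3; Box 4 5 3 4; Box 5 6 2 6];
      [:: Box 0 1 1 4; Box 0 2 0 1; Box 0 3 5 6; Box 1 2 2 3; Box 1 2 4 5; Box 5 6 3 6];
      [:: Box 0 1 5 6; Box 0 3 0 1; Box 1 2 1 3; Box 2 4 1 2; Box 3 4 5 6; Box 5 6 0 4];
      [:: Box 0 1 0 2; Box 0 1 4 6; Box 0 2 2 3; Box 1 3 1 2; Box 2 6 5 6; Box 5 6 0 2];
      [:: Box 0 1 0 6; Box 1 2 0 2; Box 3 4 2 4; Box 3 5 0 1; Box 4 6 4 5; Box 5 6 1 4];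
      [:: Box 0 1 0 2; Box 0 1 4 5; Box 0 6 5 6; Box 2 3 1 2; Box 2 4 0 1; Box 3 4 2 5];
      [:: Box 0 4 5 6; Box 1 3 3 4; Box 2 3 4 5; Box 2 4 2 3; Box 5 6 0 1; Box 5 6 2 6];
      [:: Box 0 1 0 1; Box 0 1 3 6; Box 0 3 1 2; Box 1 2 3 4; Box 1 5 5 6; Box 5 6 3 6];
      [:: Box 0 1 1 5; Box 2 3 1 3; Box 2 4 3 4; Box 3 5 0 1; Box 3 6 5 6; Box 4 5 2 5];
      [:: Box 0 4 5 6; Box 1 6 0 1; Box 2 3 2 3; Box 3 5 2 3; Box 4 5 1 2; Box 5 6 5 6];
      [:: Box 0 4 5 6; Box 1 2 0 3; Box 2 3 0 1; Box 2 4 2 3; Box 3 5 3 4; Box 3 6 1 2];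
      [:: Box 0 1 2 6; Box 0 2 0 1; Box 2 3 2 3; Box 2 6 0 1; Box 3 4 4 5; Box 5 6 2 5];
      [:: Box 0 1 5 6; Box 0 3 4 5; Box 2 4 2 3; Box 2 4 5 6; Box 3 4 0 2; Box 5 6 1 6];
      [:: Box 0 1 1 6; Box 3 4 0 2; Box 3 4 4 5; Box 3 6 3 4; Box 4 6 0 1; Box 5 6 1 2];
      [:: Box 0 1 1 4; Box 1 2 2 3; Box 1 3 0 1; Box 1 4 4 5; Box 3 4 1 2; Box 5 6 1 6];
      [:: Box 0 2 5 6; Box 0 3 0 1; Box 1 2 1 3; Box 2 4 1 2; Box 3 4 5 6; Box 5 6 0 4];
      [:: Box 0 4 1 2; Box 1 2 2 3; Box 1 2 4 6; Box 2 5 5 6; Box 3 5 2 3; Box 5 6 0 5];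
      [:: Box 0 1 1 4; Box 1 2 0 2; Box 1 2 2 3; Box 1 4 5 6; Box 3 4 2 3; Box 5 6 1 6];
      [:: Box 0 1 2 6; Box 0 6 0 1; Box 3 4 3 4; Box 3 4 4 5; Box 3 5 5 6; Box 4 5 2 3];
      [:: Box 0 5 5 6; Box 1 2 0 3; Box 1 2 4 5; Box 3 5 0 1; Box 4 6 2 3; Box 5 6 4 6];
      [:: Box 0 1 2 6; Box 0 5 1 2; Box 1 2 0 1; Box 2 6 4 5; Box 3 4 2 3; Box 4 5 2 4];
      [:: Box 0 1 0 6; Box 2 3 2 3; Box 2 4 3 4; Box 3 4 0 1; Box 3 6 5 6; Box 5 6 2 5];
      [:: Box 0 1 0 4; Box 3 4 2 4; Box 3 6 0 1; Box 3 6 5 6; Box 4 5 3 4; Box 5 6 2 4];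
      [:: Box 0 1 2 6; Box 1 3 2 3; Box 1 4 0 1; Box 2 3 3 4; Box 2 4 5 6; Box 5 6 1 6];
      [:: Box 0 1 3 6; Box 0 5 2 3; Box 1 2 4 5; Box 2 3 3 4; Box 4 6 5 6; Box 5 6 0 5];
      [:: Box 0 2 1 2; Box 0 5 5 6; Box 1 2 4 5; Box 3 4 0 5; Box 4 6 1 2; Box 5 6 4 6];
      [:: Box 0 1 3 4; Box 0 4 5 6; Box 0 5 0 1; Box 1 2 1 2; Box 3 4 2 4; Box 5 6 0 3];
      [:: Box 0 1 1 4; Box 1 2 2 3; Box 1 4 0 1; Box 1 4 4 5; Box 3 4 1 2; Box 5 6 1 6];
      [:: Box 0 4 1 2; Box 1 2 2 4; Box 1 5 5 6; Box 3 4 3 4; Box 3 6 0 1; Box 5 6 2 4];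
      [:: Box 0 1 0 5; Box 2 4 1 2; Box 3 4 4 6; Box 3 6 0 1; Box 3 6 3 4; Box 5 6 1 3];
      [:: Box 0 1 0 6; Box 2 3 1 3; Box 2 4 3 4; Box 3 5 0 1; Box 3 6 5 6; Box 4 5 2 5];
      [:: Box 0 1 0 3; Box 0 5 5 6; Box 1 2 1 2; Box 1 5 0 1; Box 3 4 1 2; Box 4 6 2 3];
      [:: Box 0 1 0 6; Box 2 3 2 3; Box 2 4 3 4; Box 3 5 2 3; Box 3 6 5 6; Box 5 6 2 5];
      [:: Box 0 1 2 4; Box 0 3 5 6; Box 0 4 0 1; Box 2 3 3 4; Box 2 5 2 3; Box 5 6 0 6];
      [:: Box 0 1 0 5; Box 2 4 1 2; Box 2 4 4 6; Box 3 6 0 1; Box 3 6 3 4; Box 5 6 1 3];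
      [:: Box 0 1 2 5; Box 0 6 0 1; Box 1 2 2 3; Box 1 4 5 6; Box 3 4 4 5; Box 5 6 2 6];
      [:: Box 0 1 0 6; Box 1 3 0 1; Box 1 4 3 4; Box 2 5 1 2; Box 3 4 2 3; Box 5 6 0 5];
      [:: Box 0 2 1 5; Box 0 5 5 6; Box 1 5 0 1; Box 3 4 3 5; Box 4 5 2 4; Box 5 6 0 6]].

Definition drawings_without_isolated (n : nat) : seq drawing :=
  match n with
  | 2 => drawings2 | 3 => drawings3 | 4 => drawings4
  | 5 => drawings5 | 6 => drawings6 | _ => [::]
  end.

(** The unit square at the far corner is alone in its row and in its column, so it
represents an isolated vertex. *)
Fixpoint drawings (n : nat) : seq drawing :=
  if n is m.+1 then
    [seq Box m n m n :: D | D <- drawings m] ++ drawings_without_isolated n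
  else [:: [::]].

Lemma drawings_tight n : 0 < n <= 6 -> all (tight_drawing n) (drawings n).
Proof. by case: n => [|[|[|[|[|[|[|//]]]]]]] // _; vm_compute. Qed.

(** * Every small graph has a drawing *)

(** Visibility is tabulated once, because the search below looks it up very often. *)
Definition visibility_table (n : nat) (D : drawing) : seq bitseq :=
  [seq [seq box_sees n D A B | B <- D] | A <- D].

Definition entry (M : seq bitseq) (i j : nat) : bool :=
  nth false (nth [::] M i) j.

(** The part above the diagonal of the adjacency matrix of [e] in the order [s]. The
row of the first vertex comes first, so adding a vertex to a graph is consing a
row. *)
Fixpoint upper_triangle (T : Type) (e : rel T) (s : seq T) : seq bitseq :=
  if s is x :: s' then [seq e x y | y <- s'] :: upper_triangle e s' else [::].

(** The induced copies, among the vertices [s] of the graph [e], of the graph with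
upper triangle [rows]. *)
Fixpoint embeddings (e : rel nat) (s : seq nat) (rows : seq bitseq) :
    seq (seq nat) :=
  if rows is b :: rows' then
    [seq x :: p | p <- embeddings e s rows',
       x <- [seq x <- s | (x \notin p) && ([seq e x y | y <- p] == b)]]
  else [:: [::]].

(** For each induced copy of [rows] in a graph [e] on [n] vertices and each vertex
outside the copy, the adjacencies of that vertex to the copy.  If [rows] has one
vertex less than [e], these are the rows whose addition to [rows] gives a graph
isomorphic to [e]. *)
Definition extension_rows (e : rel nat) (n : nat) (rows : seq bitseq) :
    seq bitseq :=
  [seq [seq e x y | y <- p] | p <- embeddings e (iota 0 n) rows,
     x <- [seq x <- iota 0 n | x \notin p]].

Fixpoint bitseqs (n : nat) : seq bitseq :=
  if n is m.+1 then
    [seq true :: b | b <- bitseqs m] ++ [seq false :: b | b <- bitseqs m]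
  else [:: [::]].

(** Here [Ms] are graphs on [n] vertices, [Ms'] graphs on one more, and [b] runs
through all possible adjacencies of a new vertex to [M].  The rows found in the
graphs [Ms'] do not depend on [b], hence are collected outside its scope. *)
Definition extensions_covered (n : nat) (Ms Ms' : seq (seq bitseq)) : bool :=
  all (fun M =>
    let rows := upper_triangle (entry M) (iota 0 n) in
    let ext := flatten [seq extension_rows (entry M') n.+1 rows | M' <- Ms'] in
    all (fun b => b \in ext) (bitseqs n)) Ms.

Definition catalogue (n : nat) : seq (seq bitseq) :=
  [seq visibility_table n D | D <- drawings n].

Lemma upper_triangle_map (T U : Type) (h : U -> T) (e : rel T) (s : seq U) :
  upper_triangle e [seq h x | x <- s] = upper_triangle (relpre h e) s.
Proof. by elim: s => //= x s ->; rewrite -map_comp. Qed.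

Lemma eq_in_upper_triangle (T : eqType) (e f : rel T) (s : seq T) : uniq s ->
  {in s &, forall x y, x != y -> e x y = f x y} ->
  upper_triangle e s = upper_triangle f s.
Proof.
elim: s => //= x s IH /andP[xs us] eq_ef; congr (_ :: _); last first.
  by apply: IH => // y z ys zs; apply: eq_ef; rewrite inE ?ys ?zs orbT.
apply/eq_in_map => y ys; apply: eq_ef; rewrite ?inE ?eqxx ?ys ?orbT //.
by apply: contraNneq xs => ->.
Qed.

Lemma upper_triangle_inj (T U : Type) (x0 : T) (y0 : U)
    (e : rel T) (f : rel U) s t :
  symmetric e -> symmetric f -> size s = size t ->
  upper_triangle e s = upper_triangle f t ->
  forall i j, i < size s -> j < size s -> i != j ->
    e (nth x0 s i) (nth x0 s j) = f (nth y0 t i) (nth y0 t j).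
Proof.
move=> syme symf.
elim: s t => [|x s IH] [|y t] //= [sz_st] [row_eq tri_eq] [|i] [|j] //= ilt jlt ij.
- have := congr1 (fun b => nth false b j) row_eq.
  by rewrite !(nth_map x0, nth_map y0) // -sz_st.
- have := congr1 (fun b => nth false b i) row_eq; rewrite syme symf.
  by rewrite !(nth_map x0, nth_map y0) // -sz_st.
exact: IH.
Qed.

Lemma embeddingsP (e : rel nat) (s : seq nat) rows p :
  p \in embeddings e s rows ->
  [/\ upper_triangle e p = rows, uniq p & {subset p <= s}].
Proof.
elim: rows p => [|b rows IH] p /=; first by rewrite inE => /eqP->.
case/allpairsPdep=> q [x [/IH[<- uq qs]]]; rewrite mem_filter.
case/andP=> /andP[xq /eqP <-] xs ->; split=> //=; first by rewrite xq.
by move=> y; rewrite inE => /predU1P[->|/qs].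
Qed.

Lemma mem_bitseqs b : b \in bitseqs (size b).
Proof. by elim: b => //= -[] b IH; rewrite mem_cat map_f ?orbT. Qed.

Lemma size_upper_triangle (T : Type) (e : rel T) s :
  size (upper_triangle e s) = size s.
Proof. by elim: s => //= x s ->. Qed.

(** An isomorphism given by matching the enumerations [u] and [q] also matches [u],
suitably reordered, with the standard enumeration of the vertices of [f]. *)
Lemma upper_triangle_relabel (T : eqType) (e : rel T) (f : rel nat) u q n :
  symmetric e -> symmetric f -> size u = n -> perm_eq q (iota 0 n) ->
  upper_triangle e u = upper_triangle f q ->
  exists2 t, perm_eq t u & upper_triangle e t = upper_triangle f (iota 0 n).
Proof.
move=> syme symf sz_u perm_q tri_eq.
case: u sz_u tri_eq => [<-|x u']; first by exists [::].
move: (x :: u') => u sz_u tri_eq.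
have uq : uniq q by rewrite (perm_uniq perm_q) iota_uniq.
have sz_q : size q = n by rewrite (perm_size perm_q) size_iota.
pose h i := nth x u (index i q).
have h_q : [seq h i | i <- q] = u.
  apply: (@eq_from_nth _ x) => [|i]; rewrite size_map sz_q ?sz_u // => i_n.
  by rewrite (nth_map 0) ?sz_q // /h index_uniq // sz_q.
exists [seq h i | i <- iota 0 n]; first by rewrite -h_q perm_sym perm_map.
rewrite upper_triangle_map; apply: eq_in_upper_triangle; first exact: iota_uniq.
move=> i j; rewrite -!(perm_mem perm_q) => iq jq ij.
rewrite /= /h (upper_triangle_inj x 0 syme symf _ tri_eq) ?sz_u ?sz_q //
  -?{1}sz_q ?index_mem ?nth_index //.
by apply: contraNneq ij => eq_idx; rewrite -(nth_index 0 iq) eq_idx nth_index.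
Qed.

(** The row of [x] is one of the [2 ^ n] rows, hence occurs as the row of some [y]
outside an induced copy [p] of [M] in some [M'].  Then [y :: p] exhausts the
vertices of [M'] and is matched with [x :: s]. *)
Lemma extensions_coveredP n Ms Ms' (T : eqType) (e : rel T) (x : T) s M :
  symmetric e -> (forall M', M' \in Ms' -> symmetric (entry M')) ->
  extensions_covered n Ms Ms' -> M \in Ms -> size s = n ->
  upper_triangle e s = upper_triangle (entry M) (iota 0 n) ->
  exists2 M', M' \in Ms' & exists2 t, perm_eq t (x :: s) &
    upper_triangle e t = upper_triangle (entry M') (iota 0 n.+1).
Proof.
move=> syme symM' /allP complete MMs sz_s tri_s.
have b_sz : size [seq e x y | y <- s] = n by rewrite size_map.
have /(allP (complete M MMs))/flattenP[_ /mapP[M' M'Ms' ->]] :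
  [seq e x y | y <- s] \in bitseqs n by rewrite -b_sz mem_bitseqs.
case/allpairsPdep=> p [y [/embeddingsP[tri_p up ps]]].
rewrite mem_filter => /andP[yp yn] row_y; exists M' => //.
have tri_eq : upper_triangle e (x :: s) = upper_triangle (entry M') (y :: p).
  by rewrite /= tri_s tri_p row_y.
have uyp : uniq (y :: p) by rewrite /= yp.
have sz_p : size p = n.
  by rewrite -(size_upper_triangle (entry M')) tri_p size_upper_triangle size_iota.
have perm_yp : perm_eq (y :: p) (iota 0 n.+1).
  have sub : {subset y :: p <= iota 0 n.+1}.
    by move=> z; rewrite inE => /predU1P[->|/ps].
  have [|_ eq_mem] := uniq_min_size uyp sub; first by rewrite size_iota /= sz_p.
  by rewrite uniq_perm ?iota_uniq.
by apply: upper_triangle_relabel tri_eq => //; [exact: symM' | rewrite /= sz_s].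
Qed.

Lemma box_sees_sym n D A B : box_sees n D A B = box_sees n D B A.
Proof.
apply: eq_has => d; apply: eq_has => k; rewrite andbCA; congr [&& _, _ & _].
by apply: eq_all => C; rewrite orbC.
Qed.

Lemma entry_visibility_table n D A0 i j : i < size D -> j < size D ->
  entry (visibility_table n D) i j = box_sees n D (nth A0 D i) (nth A0 D j).
Proof. by move=> iD jD; rewrite /entry (nth_map A0) // (nth_map A0). Qed.

Lemma entry_visibility_table_sym n D : symmetric (entry (visibility_table n D)).
Proof.
pose A0 := Box 0 0 0 0 => i j.
(* Outside the table all entries default to false. *)
have out k l : size D <= k -> entry (visibility_table n D) k l = false /\
    entry (visibility_table n D) l k = false.
  move=> Dk; split; first by rewrite /entry (nth_default [::]) ?size_map ?nth_nil.
  rewrite /entry; case: (ltnP l (size D)) => lD.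
    by rewrite (nth_map A0) // nth_default ?size_map.
  by rewrite (nth_default [::]) ?size_map ?nth_nil.
case: (ltnP i (size D)) => iD; last by have [-> ->] := out i j iD.
case: (ltnP j (size D)) => jD; last by have [-> ->] := out j i jD.
by rewrite !(entry_visibility_table n A0) // box_sees_sym.
Qed.

Lemma catalogue_sym n M : M \in catalogue n -> symmetric (entry M).
Proof. by case/mapP=> D _ ->; apply: entry_visibility_table_sym. Qed.

Lemma catalogue_step n : n < 6 ->
  extensions_covered n (catalogue n) (catalogue n.+1).
Proof. by case: n => [|[|[|[|[|[|//]]]]]] _; vm_compute. Qed.

Lemma catalogue_complete n (T : eqType) (e : rel T) s : n <= 6 ->
  symmetric e -> size s = n ->
  exists2 M, M \in catalogue n & exists2 t, perm_eq t s &
    upper_triangle e t = upper_triangle (entry M) (iota 0 n).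
Proof.
move=> n6 syme; elim: n n6 s => [_ s /size0nil -> | n IH n6 [//|x s] [sz_s]].
  by exists [::]; [|exists [::]].
have [M M_cat [t perm_ts tri_t]] := IH (ltnW n6) s sz_s.
have [||M' M'_cat [t' perm_t' tri_t']] :=
  extensions_coveredP x syme _ (catalogue_step n6) M_cat _ tri_t.
- exact: catalogue_sym.
- by rewrite (perm_size perm_ts).
exists M' => //; exists t' => //.
by rewrite (perm_trans perm_t') // perm_cons.
Qed.

(** Completeness of the drawings, with the two sides of the adjacency compared entry
by entry. *)
Lemma drawing_exists n (T : eqType) (x0 : T) (e : rel T) s : n <= 6 ->
  symmetric e -> size s = n ->
  exists2 D, D \in drawings n & exists2 t, perm_eq t s &
    forall A0 i j, i < n -> j < n -> i != j -> size D = n ->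
      e (nth x0 t i) (nth x0 t j) = box_sees n D (nth A0 D i) (nth A0 D j).
Proof.
move=> n6 syme sz_s.
have [_ /mapP[D D_n ->] [t perm_ts tri_t]] := catalogue_complete n6 syme sz_s.
exists D => //; exists t => // A0 i j i_n j_n ij sz_D.
have sz_t : size t = n by rewrite (perm_size perm_ts).
rewrite (upper_triangle_inj x0 0 syme (@entry_visibility_table_sym n D) _ tri_t);
  rewrite ?size_iota ?sz_t //.
by rewrite !nth_iota // (entry_visibility_table n A0) ?sz_D.
Qed.

(** * From grid drawings to rectangles *)

Local Open Scope ring_scope.

Definition unit_square : rect := @Rect ((0, 1), (0, 1)) isT.

Definition rect_of (b : box) : rect :=
  insubd unit_square ((b.1.1%:Z, b.1.2%:Z), (b.2.1%:Z, b.2.2%:Z)).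

Definition nondegenerate (b : box) : bool :=
  (b.1.1 < b.1.2)%N && (b.2.1 < b.2.2)%N.

Lemma rect_ofE b d : nondegenerate b ->
  (lo d (rect_of b) = (extent d b).1%:Z) *
  (hi d (rect_of b) = (extent d b).2%:Z).
Proof.
move=> ok_b; rewrite /lo /hi /x1 /x2 /y1 /y2.
have -> : corners (rect_of b) = ((b.1.1%:Z, b.1.2%:Z), (b.2.1%:Z, b.2.2%:Z)).
  by apply: (@insubdK _ _ rect) => /=; rewrite -topredE /= !ltz_nat.
by case: d.
Qed.

Lemma tight_drawingP n D : tight_drawing n D ->
  [/\ size D = n,
      forall A d, A \in D -> ((extent d A).1 < (extent d A).2 <= n)%N,
      forall d, (exists2 A, A \in D & (extent d A).1 = 0%N) /\
                (exists2 A, A \in D & (extent d A).2 = n) &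
      pairwise (fun A B => has (fun d => box_apart d A B) [:: true; false]) D].
Proof.
case/and4P=> /eqP sz_D /allP fit /and3P[touch1 touch2 _] apartD; split=> //.
  by move=> A [] /fit/and3P[].
by move=> d; have /andP[/hasP[A AD /eqP A0] /hasP[B BD /eqP Bn]] :
    has (fun A => (extent d A).1 == 0%N) D &&
    has (fun A => (extent d A).2 == n) D;
  [case: d | split; [exists A | exists B]].
Qed.

Lemma tight_nondegenerate n D A : tight_drawing n D -> A \in D -> nondegenerate A.
Proof.
move=> okD AD; have [_ fit _ _] := tight_drawingP okD; rewrite /nondegenerate.
by have /andP[-> _] := fit A true AD; have /andP[-> _] := fit A false AD.
Qed.

Lemma rectsP (D : drawing) A :
  A \in [fset rect_of b | b in D]%fset <-> exists2 b, b \in D & rect_of b = A.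
Proof.
by split=> [/imfsetP[b /= bD ->] | [b bD <-]]; [exists b | apply/imfsetP; exists b].
Qed.

Lemma tight_apart n D i j b0 : tight_drawing n D ->
  (i < size D)%N -> (j < size D)%N -> i != j ->
  exists d, apart d (rect_of (nth b0 D i)) (rect_of (nth b0 D j)).
Proof.
move=> okD; have [_ _ _ apartD] := tight_drawingP okD.
wlog ij : i j / (i < j)%N.
  move=> wl iD jD; rewrite neq_ltn => /orP[ij|ij].
    by apply: (wl i j ij iD jD); rewrite neq_ltn ij.
  have [|d] := wl j i ij jD iD; first by rewrite neq_ltn ij.
  by exists d; rewrite /apart orbC.
move=> iD jD _; have /(pairwiseP b0)/(_ i j iD jD ij)/hasP[d _ dij] := apartD; exists d.
by rewrite /apart !rect_ofE ?(tight_nondegenerate okD) ?mem_nth.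
Qed.

Lemma box_seesP n D A B : tight_drawing n D -> A \in D -> B \in D ->
  box_sees n D A B <->
  in_sight [fset rect_of b | b in D]%fset (rect_of A) (rect_of B).
Proof.
move=> okD AD BD; have [_ fit _ _] := tight_drawingP okD.
have crossesE d k C : C \in D ->
    crosses d k%:Z (rect_of C) = box_crosses d k C.
  by move=> CD; rewrite /crosses !rect_ofE ?(tight_nondegenerate okD).
have betweenE d X C Y : X \in D -> C \in D -> Y \in D ->
    between d (rect_of X) (rect_of C) (rect_of Y)
    = box_between d X C Y.
  by move=> XD CD YD; rewrite /between !rect_ofE ?(tight_nondegenerate okD).
split.
  case/hasP=> d _ /hasP[k _ /and3P[kA kB /allP clear_k]].
  exists d, k%:Z; rewrite !crossesE //; split=> // _ /rectsP[C CD <-].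
  rewrite !crossesE // !betweenE //; exact/implyP/clear_k.
case=> d [k [kA kB clear_k]].
(* Boxes have natural coordinates, so no strip with negative [k] crosses one. *)
case: k kA kB clear_k => k kA kB clear_k; last first.
  by move: kA; rewrite /crosses !rect_ofE ?(tight_nondegenerate okD).
rewrite !crossesE // in kA kB.
apply/hasP; exists d; first by case: d {kA kB clear_k}.
apply/hasP; exists k.
  by have /andP[_] := fit A d AD; case/andP: kA; rewrite mem_iota /=; lia.
rewrite kA kB; apply/allP => C CD; apply/implyP => kC.
by rewrite -!betweenE // clear_k ?crossesE //; apply/rectsP; exists C.
Qed.

Definition frame (n : nat) : rect := rect_of (Box 0 n 0 n).

Lemma frame_sides n d : (0 < n)%N ->
  (lo d (frame n) = 0) * (hi d (frame n) = n%:Z).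
Proof. by move=> n0; rewrite /frame !rect_ofE /nondegenerate /= ?n0 //; case: d. Qed.

Lemma tight_bounding_box (R : realType) n D : (0 < n)%N -> tight_drawing n D ->
  bounding_box R [fset rect_of b | b in D]%fset (frame n).
Proof.
move=> n0 okD; have [_ fit touch _] := tight_drawingP okD; split.
  move=> _ /rectsP[b bD <-]; apply/closed_rect_subP => d.
  rewrite !frame_sides // !rect_ofE ?(tight_nondegenerate okD) //.
  by have := fit b d bD; lia.
move=> a b c d inside.
have [[Al AlD Al0] [Ar ArD Arn]] := touch true.
have [[Ab AbD Ab0] [At AtD Atn]] := touch false.
have corner A h v : A \in D -> h = lo true (rect_of A) \/ h = hi true (rect_of A) ->
    v = lo false (rect_of A) \/ v = hi false (rect_of A) ->
    (a <= h%:~R <= b) && (c <= v%:~R <= d).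
  move=> AD hA vA; have /inside sub : rect_of A \in [fset rect_of b | b in D]%fset.
    by apply/rectsP; exists A.
  have [] := sub (h%:~R, v%:~R); last by rewrite /= !in_itv /= => -> ->.
  have pE (t u : R) : (pcoord true (t, u) = t) * (pcoord false (t, u) = u) by [].
  have ltA e := ltW (lo_lt_hi e (rect_of A)).
  by apply/closedP => -[]; [case: hA => -> | case: vA => ->];
    rewrite pE lexx ler_int ltA.
have := corner Al _ _ AlD (or_introl erefl) (or_introl erefl).
have := corner Ar _ _ ArD (or_intror erefl) (or_introl erefl).
have := corner Ab _ _ AbD (or_introl erefl) (or_introl erefl).
have := corner At _ _ AtD (or_introl erefl) (or_intror erefl).
rewrite !rect_ofE ?(tight_nondegenerate okD) // Al0 Arn Ab0 Atn.
move=> /andP[_ /andP[_ h1]] /andP[_ /andP[h2 _]].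
move=> /andP[/andP[_ h3] _] /andP[/andP[h4 _] _].
move=> p /closedP pf; have := pf true; have := pf false; rewrite !frame_sides //=.
by move=> /andP[? ?] /andP[? ?]; split; rewrite /= in_itv /=; apply/andP; split; lra.
Qed.

(** A bijection from the vertices to the boxes of a drawing with the same adjacency
matrix is a representation of the graph. *)
Lemma fits_frame (R : realType) (G : sgraph) : (0 < #|G| <= 6)%N ->
  exists2 S, rv_representation R S G & bounding_box R S (frame #|G|).
Proof.
move=> /andP[G0 G6]; set n := #|G|.
have /card_gt0P[v0 _] := G0.
have [D D_n [t perm_t adj_t]] := drawing_exists v0 G6 (@adj_sym G) (esym (cardE G)).
have okD : tight_drawing n D by apply: (allP (drawings_tight _)); rewrite ?G0.
have [sz_D _ _ _] := tight_drawingP okD.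
pose b0 := Box 0 0 0 0.
have t_all v : v \in t by rewrite (perm_mem perm_t) mem_enum.
have sz_t : size t = n by rewrite (perm_size perm_t) -cardE.
have idx v : (index v t < n)%N by rewrite -sz_t index_mem.
have idx_inj : injective (index^~ t).
  by move=> u v eq_uv; rewrite -(nth_index v0 (t_all u)) eq_uv nth_index.
exists [fset rect_of b | b in D]%fset; last exact: tight_bounding_box.
have disjD : disjoint_interiors R [fset rect_of b | b in D]%fset.
  apply/disjoint_interiorsP => _ _ /rectsP[A AD <-] /rectsP[B BD <-] neqAB.
  rewrite -(nth_index b0 AD) -(nth_index b0 BD); apply: (tight_apart b0 okD);
    rewrite ?index_mem //.
  by apply: contraNneq neqAB => eq_i; rewrite -(nth_index b0 AD) eq_i nth_index.
split=> //; exists (fun v => rect_of (nth b0 D (index v t))).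
have f_inj : injective (fun v => rect_of (nth b0 D (index v t))).
  move=> u v eq_uv; apply/idx_inj/eqP/contraT => neq_uv.
  have [] := tight_apart b0 okD _ _ neq_uv; rewrite ?sz_D // => d.
  by rewrite eq_uv /apart leNgt lo_lt_hi.
split=> // [A|u v neq_uv].
  split=> [/rectsP[b bD <-]|[v <-]]; last first.
    by apply/rectsP; exists (nth b0 D (index v t)); rewrite // mem_nth ?sz_D.
  exists (nth v0 t (index b D)); rewrite index_uniq ?nth_index //.
    by rewrite sz_t -sz_D index_mem.
  by rewrite (perm_uniq perm_t) enum_uniq.
have inD w : nth b0 D (index w t) \in D by rewrite mem_nth ?sz_D.
have -> : adj u v = box_sees n D (nth b0 D (index u t)) (nth b0 D (index v t)).
  by rewrite -(adj_t b0) ?idx ?(inj_eq idx_inj) // !nth_index.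
apply: iff_trans (box_seesP okD _ _) (iff_sym (seesP disjD _ _ _)) => //.
- by apply/rectsP; exists (nth b0 D (index u t)).
- by apply/rectsP; exists (nth b0 D (index v t)).
- by rewrite (inj_eq f_inj).
Qed.

(** Both minima are taken over nonempty sets; the one for [G] is at most the value
for the square of side [#|G|], the one for the edgeless graph is attained by a box
at least as long and as high. *)
Lemma min_over_boxes_le_edgeless (R : realType) (G : sgraph) (q : rect -> nat) :
  (0 < #|G| <= 6)%N ->
  (forall B, (#|G| <= x_length B)%N -> (#|G| <= y_length B)%N ->
     (q (frame #|G|) <= q B)%N) ->
  (min_over_boxes R G q <= min_over_boxes R (edgeless #|G|) q)%N.
Proof.
move=> szG q_mono; rewrite /min_over_boxes.
have attained (H : sgraph) : #|H| = #|G| -> exists2 S, rv_representation R S H &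
    bounding_box R S (frame #|G|).
  by move=> eqHG; rewrite -eqHG; apply: fits_frame; rewrite eqHG.
have [S repS boxS] := attained G erefl.
have [S' repS' boxS'] := attained (edgeless #|G|) (card_ord _).
have [|[S0 [B [rep0 [inB _] <-]]] _] :=
  @min_natP [set m | exists S B, [/\ rv_representation R S (edgeless #|G|),
    bounding_box R S B & q B = m]]%classic.
  by exists (q (frame #|G|)), S', (frame #|G|).
have [|_ min_le] := @min_natP [set m | exists S B, [/\ rv_representation R S G,
    bounding_box R S B & q B = m]]%classic.
  by exists (q (frame #|G|)), S, (frame #|G|).
apply: (@leq_trans (q (frame #|G|))); first by apply: min_le; exists S, (frame #|G|).
apply: q_mono; [exact: edgeless_box true rep0 inB|].
exact: edgeless_box false rep0 inB.
Qed.

Theorem theorem6p1 (R : realType) (n : nat) (hn : (1 <= n <= 6)%N)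
    (G : sgraph) (hG : #|G| = n) (hrvg : is_rvg R G) :
  [/\ (height R G <= height R (edgeless n))%N,
      (width R G <= width R (edgeless n))%N,
      (area R G <= area R (edgeless n))%N &
      (perim R G <= perim R (edgeless n))%N].
Proof.
rewrite -hG in hn *; have /andP[G0 _] := hn.
have frame_x : x_length (frame #|G|) = #|G|.
  by have := frame_sides true G0; rewrite /x_length /lo /hi => -[-> ->]; rewrite subr0.
have frame_y : y_length (frame #|G|) = #|G|.
  by have := frame_sides false G0; rewrite /y_length /lo /hi => -[-> ->]; rewrite subr0.
have h_mono B : (#|G| <= x_length B)%N -> (#|G| <= y_length B)%N ->
    (box_height (frame #|G|) <= box_height B)%N.
  by rewrite /box_height frame_x frame_y; lia.
have w_mono B : (#|G| <= x_length B)%N -> (#|G| <= y_length B)%N ->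
    (box_width (frame #|G|) <= box_width B)%N.
  by rewrite /box_width frame_x frame_y; lia.
split; apply: min_over_boxes_le_edgeless => // B xB yB.
- by rewrite leq_mul ?h_mono ?w_mono.
- by rewrite leq_mul // leq_add ?h_mono ?w_mono.
Qed.
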